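(* Let $\beta_c=\log 4$. For all $0<\beta\le\beta_c$, the critical value $K_c^{(2)}(\beta)=1/(2\beta c_\beta''(0))$ has the following properties. (a) For $0<K\le K_c^{(2)}(\beta)$, $\tilde{\mathcal{E}}_{\beta,K}=\{0\}$. (b) For $K>K_c^{(2)}(\beta)$, there exists a positive number $\tilde z(\beta,K)$ such that $\tilde{\mathcal{E}}_{\beta,K}=\{\pm\tilde z(\beta,K)\}$. (c) $\tilde z(\beta,K)$ is a strictly increasing continuous function of $K$ for $K>K_c^{(2)}(\beta)$, and $\tilde z(\beta,K)\to0$ as $K\to(K_c^{(2)}(\beta))^+$. (In this sense $\tilde{\mathcal{E}}_{\beta,K}$ exhibits a continuous bifurcation at $K_c^{(2)}(\beta)$.)
   Context: Let $\Lambda=\{-1,0,1\}$, $\rho=\frac13(\delta_{-1}+\delta_0+\delta_1)$ and, for $\beta>0$, $\rho_\beta(dy)=\frac{1}{Z(\beta)}e^{-\beta y^2}\rho(dy)$ with $Z(\beta)=\int_\Lambda e^{-\beta y^2}\rho(dy)$. Define $$c_\beta(t)=\log\int_\Lambda e^{ty}\rho_\beta(dy)=\log\Big[\frac{1+e^{-\beta}(e^t+e^{-t})}{1+2e^{-\beta}}\Big],\qquad J_\beta(z)=\sup_{t\in\mathbb{R}}\{tz-c_\beta(t)\}.$$ For $\beta>0,K>0$ the set of canonical equilibrium macrostates for the spin per site is $$\tilde{\mathcal{E}}_{\beta,K}=\{z\in[-1,1]: z\text{ minimizes }J_\beta(z)-\beta Kz^2\text{ over }[-1,1]\};$$ equivalently,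 with $F_{\beta,K}(w)=\frac{w^2}{4\beta K}-c_\beta(w)$ for $w\in\mathbb{R}$, $$\tilde{\mathcal{E}}_{\beta,K}=\Big\{\frac{w}{2\beta K}\in\mathbb{R}: w\text{ minimizes }F_{\beta,K}(w)\text{ over }\mathbb{R}\Big\}.$$ Explicitly, $1/(2\beta c_\beta''(0))=\frac{1}{4\beta e^{-\beta}}+\frac1{2\beta}$. *)

(* Defs.v *)
From Stdlib Require Import Reals Lra List.
From Coquelicot Require Import Coquelicot.
Import ListNotations.
Open Scope R_scope.

Definition Lambda : list R := [-1; 0; 1].

(** A measure on the finite set [Lambda] is given by its point masses
    [m y = m({y})]; only the values of [m] and [f] on [Lambda] matter. *)
Definition integral_Lambda (m f : R -> R) : R :=
  fold_right Rplus 0 (map (fun y => f y * m y) Lambda).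

Definition rho (y : R) : R := 1 / 3.

Definition partition_function (beta : R) : R :=
  integral_Lambda rho (fun y => exp (- beta * y ^ 2)).

Definition rho_beta (beta y : R) : R :=
  1 / partition_function beta * exp (- beta * y ^ 2) * rho y.

Definition c_beta (beta t : R) : R :=
  ln (integral_Lambda (rho_beta beta) (fun y => exp (t * y))).

(** The supremum is taken in the extended reals: it is finite for [|z| <= 1]
    and [p_infty] for [|z| > 1]. *)
Definition J_beta (beta z : R) : Rbar :=
  Lub_Rbar (fun v => exists t : R, v = t * z - c_beta beta t).

Definition canonical_objective (beta K z : R) : Rbar :=
  Rbar_minus (J_beta beta z) (beta * K * z ^ 2).

Definition canonical_macrostates (beta K z : R) : Prop :=
  -1 <= z <= 1 /\
  forall x : R, -1 <= x <= 1 ->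
    Rbar_le (canonical_objective beta K z) (canonical_objective beta K x).

Definition beta_c : R := ln 4.

Definition K_c2 (beta : R) : R := 1 / (2 * beta * Derive_n (c_beta beta) 2 0).

Lemma c_beta_explicit (beta t : R) :
  c_beta beta t =
  ln ((1 + exp (- beta) * (exp t + exp (- t))) / (1 + 2 * exp (- beta))).
Proof.
unfold c_beta, rho_beta, partition_function, rho, integral_Lambda, Lambda; simpl.
replace (- beta * (-1 * (-1 * 1))) with (- beta) by ring.
replace (- beta * (0 * (0 * 1))) with 0 by ring.
replace (- beta * (1 * (1 * 1))) with (- beta) by ring.
replace (t * -1) with (- t) by ring.
replace (t * 0) with 0 by ring.
replace (t * 1) with t by ring.
rewrite exp_0; f_equal.
pose proof (exp_pos (- beta)); field; lra.
Qed.

Lemma K_c2_explicit (beta : R) :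
  0 < beta -> K_c2 beta = 1 / (4 * beta * exp (- beta)) + 1 / (2 * beta).
Proof.
intros hb; pose proof (exp_pos (- beta)) as he.
assert (pos : forall t, 0 < 1 + exp (- beta) * (exp t + exp (- t))).
{ intro t; pose proof (exp_pos t); pose proof (exp_pos (- t)); nra. }
assert (D1 : forall t, Derive (c_beta beta) t =
  exp (- beta) * (exp t - exp (- t)) / (1 + exp (- beta) * (exp t + exp (- t)))).
{ intro t; rewrite (Derive_ext _ _ t (c_beta_explicit beta)).
  apply is_derive_unique; specialize (pos t); auto_derive.
  - apply Rdiv_lt_0_compat; lra.
  - field; split; lra. }
assert (E : Derive_n (c_beta beta) 2 0 = Derive (fun t => Derive (c_beta beta) t) 0)
  by reflexivity.
unfold K_c2; rewrite E.
rewrite (Derive_ext (fun t => Derive (c_beta beta) t) _ 0 D1).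
assert (D2 : Derive (fun t => exp (- beta) * (exp t - exp (- t)) /
    (1 + exp (- beta) * (exp t + exp (- t)))) 0 =
  2 * exp (- beta) / (1 + 2 * exp (- beta))).
{ apply is_derive_unique; specialize (pos 0); auto_derive.
  - lra.
  - rewrite Ropp_0, exp_0; field; lra. }
rewrite D2; field; lra.
Qed.

(* Main.v *)
(** Since [c_beta] is convex, the Legendre bound [J_beta z >= t z - c_beta t] at
    [t = 2 beta K z] shows that the canonical objective at [z] dominates the
    free energy [F w = w^2 / (4 beta K) - c_beta w] at [w = 2 beta K z], with
    equality when [w] is a critical point of [F].  So macrostates are the
    rescaled minimizers of [F].  With [a = exp (- beta)], the second derivative
    of [c_beta] is a rational function of [cosh w] that is strictly decreasing on
    [w >= 0] exactly when [a >= 1/4], i.e. [beta <= log 4].  Hence the slope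
    [c_beta' w / w] decreases strictly from [c_beta'' 0], and the critical point
    equation [c_beta' w / w = 1 / (2 beta K)] has a positive solution, then
    unique and increasing in [K], precisely when [K > K_c2 beta]. *)

Require Import Defs.
From Stdlib Require Import Reals Lra IndefiniteDescription.
From Coquelicot Require Import Coquelicot.
Open Scope R_scope.

(** * Derivatives of [c_beta]: sign, symmetry, bounds and continuity *)

Definition c_beta_deriv (beta t : R) : R :=
  exp (- beta) * (exp t - exp (- t)) / (1 + exp (- beta) * (exp t + exp (- t))).

(** The term [4 * exp (- beta) ^ 2] comes from [(exp t + exp (- t)) ^ 2 - (exp t - exp (- t)) ^ 2 =
    4] in the quotient rule. *)
Definition c_beta_deriv2 (beta t : R) : R :=
  (exp (- beta) * (exp t + exp (- t)) + 4 * exp (- beta) ^ 2) /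
  (1 + exp (- beta) * (exp t + exp (- t))) ^ 2.

Definition free_energy (beta K w : R) : R := w ^ 2 / (4 * beta * K) - c_beta beta w.

Lemma exp_mul_exp_neg (t : R) : exp t * exp (- t) = 1.
Proof. rewrite <- exp_plus, Rplus_opp_r; apply exp_0. Qed.

Lemma exp_neg_beta_ge (beta : R) : beta <= beta_c -> 1 / 4 <= exp (- beta).
Proof.
intros hb; replace (1 / 4) with (exp (- beta_c)).
- destruct (Req_dec beta beta_c) as [-> | hne]; [lra |].
  left; apply exp_increasing; lra.
- unfold beta_c; rewrite exp_Ropp, exp_ln; lra.
Qed.

Lemma denominator_pos (beta t : R) : 0 < 1 + exp (- beta) * (exp t + exp (- t)).
Proof.
pose proof (exp_pos (- beta)); pose proof (exp_pos t); pose proof (exp_pos (- t)); nra.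
Qed.

Lemma is_derive_c_beta (beta t : R) : is_derive (c_beta beta) t (c_beta_deriv beta t).
Proof.
apply is_derive_ext with
  (fun t => ln ((1 + exp (- beta) * (exp t + exp (- t))) / (1 + 2 * exp (- beta)))).
- intros s; symmetry; apply c_beta_explicit.
- pose proof (denominator_pos beta t); pose proof (exp_pos (- beta)).
  unfold c_beta_deriv; auto_derive.
  + apply Rdiv_lt_0_compat; lra.
  + field; split; lra.
Qed.

Lemma is_derive_c_beta_deriv (beta t : R) :
  is_derive (c_beta_deriv beta) t (c_beta_deriv2 beta t).
Proof.
pose proof (denominator_pos beta t) as hd.
unfold c_beta_deriv, c_beta_deriv2; auto_derive; [lra |].
pose proof (exp_mul_exp_neg t) as hm.
replace (4 * exp (- beta) ^ 2) with (4 * exp (- beta) ^ 2 * (exp t * exp (- t)))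
  by (rewrite hm; ring).
field; lra.
Qed.

Lemma c_beta_mvt (beta x y : R) : x < y ->
  exists u, c_beta beta y - c_beta beta x = c_beta_deriv beta u * (y - x) /\ x < u < y.
Proof.
intros hxy; apply MVT_cor2; [exact hxy |].
intros u _; apply is_derive_Reals, is_derive_c_beta.
Qed.

Lemma c_beta_deriv_mvt (beta x y : R) : x < y ->
  exists u, c_beta_deriv beta y - c_beta_deriv beta x =
    c_beta_deriv2 beta u * (y - x) /\ x < u < y.
Proof.
intros hxy; apply MVT_cor2; [exact hxy |].
intros u _; apply is_derive_Reals, is_derive_c_beta_deriv.
Qed.

Lemma c_beta_deriv2_pos (beta t : R) : 0 < c_beta_deriv2 beta t.
Proof.
unfold c_beta_deriv2; apply Rdiv_lt_0_compat.
- pose proof (exp_pos (- beta)); pose proof (exp_pos t); pose proof (exp_pos (- t)); nra.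
- apply pow_lt, denominator_pos.
Qed.

Lemma c_beta_deriv_increasing (beta x y : R) :
  x < y -> c_beta_deriv beta x < c_beta_deriv beta y.
Proof.
intros hxy; destruct (c_beta_deriv_mvt beta x y hxy) as [u [hu _]].
pose proof (c_beta_deriv2_pos beta u); nra.
Qed.

Lemma c_beta_deriv_0 (beta : R) : c_beta_deriv beta 0 = 0.
Proof. unfold c_beta_deriv, Rdiv; rewrite Ropp_0; ring. Qed.

Lemma c_beta_deriv_opp (beta t : R) : c_beta_deriv beta (- t) = - c_beta_deriv beta t.
Proof.
unfold c_beta_deriv; rewrite Ropp_involutive.
pose proof (denominator_pos beta t); field; lra.
Qed.

Lemma c_beta_deriv_bounds (beta t : R) : -1 < c_beta_deriv beta t < 1.
Proof.
pose proof (denominator_pos beta t); pose proof (exp_pos (- beta)).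
pose proof (exp_pos t); pose proof (exp_pos (- t)).
unfold c_beta_deriv; split.
- apply Rlt_div_r; nra.
- apply Rlt_div_l; nra.
Qed.

Lemma continuous_c_beta_deriv (beta t : R) : continuous (c_beta_deriv beta) t.
Proof.
apply (ex_derive_continuous (K := R_AbsRing) (V := R_NormedModule)); eexists; apply is_derive_c_beta_deriv.
Qed.

Lemma continuous_c_beta_deriv2 (beta t : R) : continuous (c_beta_deriv2 beta) t.
Proof.
apply (ex_derive_continuous (K := R_AbsRing) (V := R_NormedModule)); unfold c_beta_deriv2; auto_derive.
pose proof (denominator_pos beta t); apply Rgt_not_eq; nra.
Qed.

Lemma c_beta_opp (beta t : R) : c_beta beta (- t) = c_beta beta t.
Proof.
rewrite !c_beta_explicit, Ropp_involutive; do 3 f_equal; ring.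
Qed.

(** Convexity: the increment from [t] to [s] is [c_beta_deriv beta u * (s - t)] with [u] in between,
    and the derivative is increasing. *)
Lemma c_beta_tangent_le (beta s t : R) :
  c_beta beta t + c_beta_deriv beta t * (s - t) <= c_beta beta s.
Proof.
destruct (Rtotal_order s t) as [h | [-> | h]]; [| lra |].
- destruct (c_beta_mvt beta s t h) as [u [hu hut]].
  pose proof (c_beta_deriv_increasing beta u t ltac:(lra)); nra.
- destruct (c_beta_mvt beta t s h) as [u [hu hut]].
  pose proof (c_beta_deriv_increasing beta t u ltac:(lra)); nra.
Qed.

(** * Strict concavity of [c_beta_deriv] on the nonnegative half-line *)

Lemma exp_add_exp_neg_increasing (x y : R) :
  0 <= x < y -> exp x + exp (- x) < exp y + exp (- y).
Proof.
intros [hx hxy].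
pose proof (exp_increasing x y hxy); pose proof (exp_ineq1_le x).
pose proof (exp_mul_exp_neg x); pose proof (exp_mul_exp_neg y).
pose proof (exp_pos (- x)); pose proof (exp_pos (- y)).
assert (1 < exp x * exp y) by nra.
(* Clearing the negative exponentials factors the increment; both factors on the right are
   positive. *)
assert (E : (exp y + exp (- y) - (exp x + exp (- x))) * (exp x * exp y) =
  (exp y - exp x) * (exp x * exp y - 1)).
{ replace (exp y + exp (- y) - (exp x + exp (- x))) with
    ((exp y - exp x) + (exp (- y) - exp (- x))) by ring.
  rewrite Rmult_plus_distr_r.
  replace ((exp (- y) - exp (- x)) * (exp x * exp y)) with
    (exp x * (exp y * exp (- y)) - exp y * (exp x * exp (- x))) by ring.
  rewrite H1, H2; ring. }
nra.
Qed.

(** In [u = a * (exp x + exp (- x))] the second derivative is [(u + 4 a^2) / (1 + u)^2]. The sign of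
    a difference of two values is decided by a factor increasing in [u, v >= 2 a], and
    [beta <= beta_c], that is [a >= 1/4], makes it nonnegative at the corner [u = v = 2 a]. *)
Lemma c_beta_deriv2_decreasing (beta x y : R) : beta <= beta_c ->
  0 <= x < y -> c_beta_deriv2 beta y < c_beta_deriv2 beta x.
Proof.
intros hb hxy.
pose proof (exp_neg_beta_ge beta hb) as ha.
pose proof (exp_add_exp_neg_increasing x y hxy) as hs.
assert (h2 : 2 <= exp x + exp (- x)).
{ pose proof (exp_mul_exp_neg x); pose proof (exp_pos x); pose proof (exp_pos (- x)).
  pose proof (Rle_0_sqr (exp x - exp (- x))); unfold Rsqr in *; nra. }
unfold c_beta_deriv2.
set (a := exp (- beta)) in *.
set (s := exp x + exp (- x)) in *; set (r := exp y + exp (- y)) in *.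
assert (hu : 2 * a <= a * s) by nra.
assert (huv : a * s < a * r) by nra.
set (u := a * s) in *; set (v := a * r) in *.
apply Rlt_0_minus.
replace ((u + 4 * a ^ 2) / (1 + u) ^ 2 - (v + 4 * a ^ 2) / (1 + v) ^ 2) with
  ((v - u) * (u * v - 1 + 4 * a ^ 2 * (2 + u + v)) / ((1 + u) ^ 2 * (1 + v) ^ 2))
  by (field; lra).
(* At [u = v = 2 a] the middle factor is [(4 a - 1) (2 a + 1) ^ 2]. *)
assert (0 <= (4 * a - 1) * (2 * a + 1) ^ 2) by (apply Rmult_le_pos; [lra | apply pow2_ge_0]).
assert (4 * a * a < u * v) by nra.
assert (4 * a ^ 2 * (2 + 4 * a) <= 4 * a ^ 2 * (2 + u + v))
  by (apply Rmult_le_compat_l; nra).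
apply Rdiv_lt_0_compat.
- apply Rmult_lt_0_compat; nra.
- apply Rmult_lt_0_compat; apply pow_lt; lra.
Qed.

(** Cross-multiplied form of the strict decrease of [c_beta_deriv beta t / t]: the mean slope over
    [[0, x]] exceeds the one over [[x, y]]. *)
Lemma c_beta_deriv_slope_decreasing (beta x y : R) : beta <= beta_c ->
  0 < x < y -> x * c_beta_deriv beta y < y * c_beta_deriv beta x.
Proof.
intros hb [hx hxy].
destruct (c_beta_deriv_mvt beta 0 x hx) as [u [hu hux]].
destruct (c_beta_deriv_mvt beta x y hxy) as [v [hv hvy]].
rewrite c_beta_deriv_0, !Rminus_0_r in hu.
pose proof (c_beta_deriv2_decreasing beta u v hb ltac:(lra)).
assert (0 < x * (y - x)) by nra.
assert (x * (y - x) * c_beta_deriv2 beta v < x * (y - x) * c_beta_deriv2 beta u)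
  by (apply Rmult_lt_compat_l; lra).
nra.
Qed.

Lemma c_beta_deriv_lt_linear (beta w : R) : beta <= beta_c ->
  0 < w -> c_beta_deriv beta w < c_beta_deriv2 beta 0 * w.
Proof.
intros hb hw.
destruct (c_beta_deriv_mvt beta 0 w hw) as [u [hu huw]].
rewrite c_beta_deriv_0, !Rminus_0_r in hu; rewrite hu.
apply Rmult_lt_compat_r; [lra | apply c_beta_deriv2_decreasing; lra].
Qed.

(** * The critical value, the free energy and the canonical objective *)

Lemma K_c2_mul (beta : R) :
  0 < beta -> K_c2 beta * (2 * beta * c_beta_deriv2 beta 0) = 1.
Proof.
intros hb; rewrite K_c2_explicit by lra; unfold c_beta_deriv2.
rewrite Ropp_0, exp_0; pose proof (exp_pos (- beta)); field; lra.
Qed.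

Lemma K_c2_pos (beta : R) : 0 < beta -> 0 < K_c2 beta.
Proof.
intros hb; pose proof (K_c2_mul beta hb); pose proof (c_beta_deriv2_pos beta 0).
assert (0 < 2 * beta * c_beta_deriv2 beta 0) by nra; nra.
Qed.

Lemma free_energy_opp (beta K w : R) : free_energy beta K (- w) = free_energy beta K w.
Proof. unfold free_energy; rewrite c_beta_opp; unfold Rdiv; ring. Qed.

(** Scaling by [2 * beta * K] clears the denominator of the derivative, so monotonicity is read off
    the sign of [u - 2 * beta * K * c_beta_deriv beta u]. *)
Lemma free_energy_mvt (beta K x y : R) : 0 < beta -> 0 < K -> x < y ->
  exists u, 2 * beta * K * (free_energy beta K y - free_energy beta K x) =
    (u - 2 * beta * K * c_beta_deriv beta u) * (y - x) /\ x < u < y.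
Proof.
intros hb hK hxy.
destruct (MVT_cor2 (free_energy beta K)
  (fun w => w / (2 * beta * K) - c_beta_deriv beta w) x y hxy) as [u [hu hux]].
- intros u _; apply is_derive_Reals; unfold free_energy.
  apply @is_derive_minus; [auto_derive; [easy | field; lra] | apply is_derive_c_beta].
- exists u; split; [rewrite hu; field; lra | exact hux].
Qed.

Lemma free_energy_le_objective (beta K z : R) : 0 < beta -> 0 < K ->
  Rbar_le (free_energy beta K (2 * beta * K * z)) (canonical_objective beta K z).
Proof.
intros hb hK.
assert (hJ : Rbar_le (2 * beta * K * z * z - c_beta beta (2 * beta * K * z)) (J_beta beta z))
  by (apply (proj1 (Lub_Rbar_correct _)); eexists; reflexivity).
unfold canonical_objective, free_energy.
replace ((2 * beta * K * z) ^ 2 / (4 * beta * K)) with (beta * K * z ^ 2)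
  by (field; lra).
(* The value [p_infty] makes the bound trivial, and [hJ] excludes [m_infty]. *)
destruct (J_beta beta z) as [j | |]; simpl in *; try easy; lra.
Qed.

(** By the tangent bound, the supremum is attained at [t = w]. *)
Lemma J_beta_at_slope (beta w : R) :
  J_beta beta (c_beta_deriv beta w) = Finite (w * c_beta_deriv beta w - c_beta beta w).
Proof.
apply is_lub_Rbar_unique; split.
- intros v [t ->]; simpl.
  pose proof (c_beta_tangent_le beta t w); lra.
- intros m hm; apply hm; eexists; reflexivity.
Qed.

Lemma objective_at_critical (beta K z : R) : 0 < beta -> 0 < K ->
  z = c_beta_deriv beta (2 * beta * K * z) ->
  canonical_objective beta K z = Finite (free_energy beta K (2 * beta * K * z)).
Proof.
intros hb hK hz; unfold canonical_objective, free_energy.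
rewrite hz at 1; rewrite J_beta_at_slope, <- hz; simpl; f_equal; field; lra.
Qed.

(** The objective at [z] equals the free energy there, which is at most the free energy at the
    rescaled [x], hence at most the objective at [x]. *)
Lemma macrostate_of_critical_minimum (beta K z : R) : 0 < beta -> 0 < K ->
  z = c_beta_deriv beta (2 * beta * K * z) ->
  (forall w, free_energy beta K (2 * beta * K * z) <= free_energy beta K w) ->
  canonical_macrostates beta K z.
Proof.
intros hb hK hz hmin; split.
- rewrite hz; pose proof (c_beta_deriv_bounds beta (2 * beta * K * z)); lra.
- intros x _; rewrite (objective_at_critical beta K z hb hK hz).
  eapply Rbar_le_trans; [| apply free_energy_le_objective; assumption].
  apply hmin.
Qed.

(** Only [y] has to be critical: the free energy at [z] is bounded by the objective at [z], then by
    the objective at [y], which equals the free energy there. *)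
Lemma free_energy_macrostate_le (beta K z y : R) : 0 < beta -> 0 < K ->
  canonical_macrostates beta K z ->
  y = c_beta_deriv beta (2 * beta * K * y) ->
  free_energy beta K (2 * beta * K * z) <= free_energy beta K (2 * beta * K * y).
Proof.
intros hb hK [_ hz] hy.
assert (h : Rbar_le (free_energy beta K (2 * beta * K * z))
  (free_energy beta K (2 * beta * K * y))); [| exact h].
rewrite <- (objective_at_critical beta K y hb hK hy).
eapply Rbar_le_trans; [apply free_energy_le_objective; assumption |].
apply hz; rewrite hy.
pose proof (c_beta_deriv_bounds beta (2 * beta * K * y)); lra.
Qed.

(** * Macrostates below and above the critical value *)

Lemma macrostates_subcritical (beta K z : R) : 0 < beta <= beta_c ->
  0 < K <= K_c2 beta -> canonical_macrostates beta K z <-> z = 0.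
Proof.
intros [hb hbc] [hK hKc].
assert (pos : forall w, 0 < w -> free_energy beta K 0 < free_energy beta K w).
(* For [K <= K_c2 beta], [2 * beta * K * c_beta_deriv beta u] is less than
   [2 * beta * K * c_beta_deriv2 beta 0 * u], which is at most [u]. *)
{ intros w hw; destruct (free_energy_mvt beta K 0 w hb hK hw) as [u [hu huw]].
  pose proof (c_beta_deriv_lt_linear beta u hbc ltac:(lra)) as hlin.
  pose proof (K_c2_mul beta hb) as hmul.
  pose proof (c_beta_deriv2_pos beta 0) as h2.
  assert (0 < 2 * beta * c_beta_deriv2 beta 0) by nra.
  assert (hle : K * (2 * beta * c_beta_deriv2 beta 0) <= 1) by nra.
  assert (0 < 2 * beta * K) by nra.
  assert (2 * beta * K * c_beta_deriv beta u <
          2 * beta * K * (c_beta_deriv2 beta 0 * u)) by (apply Rmult_lt_compat_l; lra).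
  assert (0 < u - 2 * beta * K * c_beta_deriv beta u) by nra.
  assert (0 < (u - 2 * beta * K * c_beta_deriv beta u) * (w - 0)) by nra.
  nra. }
assert (strict : forall w, w <> 0 -> free_energy beta K 0 < free_energy beta K w).
{ intros w hw; destruct (Rlt_or_le 0 w) as [h | h]; [now apply pos |].
  rewrite <- (free_energy_opp beta K w); apply pos; lra. }
assert (crit : 0 = c_beta_deriv beta (2 * beta * K * 0))
  by (rewrite Rmult_0_r; symmetry; apply c_beta_deriv_0).
split.
- intros hz.
  pose proof (free_energy_macrostate_le beta K z 0 hb hK hz crit) as hle.
  rewrite Rmult_0_r in hle.
  destruct (Req_dec z 0) as [h0 | h0]; [exact h0 |].
  assert (hne : 2 * beta * K * z <> 0)
    by (repeat apply Rmult_integral_contrapositive_currified; lra).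
  specialize (strict _ hne); lra.
- intros ->; apply macrostate_of_critical_minimum; try assumption.
  intros w; rewrite Rmult_0_r.
  destruct (Req_dec w 0) as [-> | hw]; [lra | left; now apply strict].
Qed.

(** On the nonnegative half-line the free energy falls up to [w] and rises after it; evenness then
    leaves [w] and [- w] as its only minimizers. *)
Lemma macrostates_supercritical (beta K w z : R) : 0 < beta <= beta_c -> 0 < K ->
  0 < w -> w = 2 * beta * K * c_beta_deriv beta w ->
  canonical_macrostates beta K z <-> (z = c_beta_deriv beta w \/ z = - c_beta_deriv beta w).
Proof.
intros [hb hbc] hK hw hcrit.
assert (hk : 0 < 2 * beta * K) by (repeat apply Rmult_lt_0_compat; lra).
assert (pos : forall x, 0 <= x -> x <> w -> free_energy beta K w < free_energy beta K x).
{ intros x hx hne; destruct (Rdichotomy _ _ hne) as [h | h].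
  - destruct (free_energy_mvt beta K x w hb hK h) as [u [hu hux]].
    pose proof (c_beta_deriv_slope_decreasing beta u w hbc ltac:(lra)) as hs.
    apply (Rmult_lt_compat_l (2 * beta * K)) in hs; [| exact hk].
    (* By the critical equation, [hs] reads [u * w < w * (2 * beta * K * c_beta_deriv beta u)];
       cancel [w]. *)
    assert (u < 2 * beta * K * c_beta_deriv beta u) by nra.
    assert ((u - 2 * beta * K * c_beta_deriv beta u) * (w - x) < 0) by nra.
    nra.
  - destruct (free_energy_mvt beta K w x hb hK h) as [u [hu hux]].
    pose proof (c_beta_deriv_slope_decreasing beta w u hbc ltac:(lra)) as hs.
    apply (Rmult_lt_compat_l (2 * beta * K)) in hs; [| exact hk].
    assert (2 * beta * K * c_beta_deriv beta u < u) by nra.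
    assert (0 < (u - 2 * beta * K * c_beta_deriv beta u) * (x - w)) by nra.
    nra. }
assert (strict : forall x, x <> w -> x <> - w ->
  free_energy beta K w < free_energy beta K x).
{ intros x h1 h2; destruct (Rle_or_lt 0 x); [now apply pos |].
  rewrite <- (free_energy_opp beta K x); apply pos; lra. }
assert (hmin : forall x, free_energy beta K w <= free_energy beta K x).
{ intros x; destruct (Req_dec x w) as [-> | h1]; [lra |].
  destruct (Req_dec x (- w)) as [-> | h2]; [rewrite free_energy_opp; lra |].
  left; now apply strict. }
set (y := c_beta_deriv beta w) in *.
assert (hy : y = c_beta_deriv beta (2 * beta * K * y)) by (rewrite <- hcrit; reflexivity).
assert (hyn : 2 * beta * K * - y = - w) by lra.
split.
- intros hz.
  pose proof (free_energy_macrostate_le beta K z y hb hK hz hy) as hle.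
  rewrite <- hcrit in hle.
  destruct (Req_dec (2 * beta * K * z) w) as [h1 | h1].
  + left; apply Rmult_eq_reg_l with (2 * beta * K); lra.
  + destruct (Req_dec (2 * beta * K * z) (- w)) as [h2 | h2].
    * right; apply Rmult_eq_reg_l with (2 * beta * K); lra.
    * specialize (strict _ h1 h2); lra.
- intros [-> | ->]; apply macrostate_of_critical_minimum; try assumption.
  + rewrite <- hcrit; exact hmin.
  + rewrite hyn, c_beta_deriv_opp; reflexivity.
  + rewrite hyn, free_energy_opp; exact hmin.
Qed.

(** * Positive critical points and their dependence on [K] *)

Lemma critical_point_exists (beta K : R) : 0 < beta -> K_c2 beta < K ->
  exists w, 0 < w /\ w = 2 * beta * K * c_beta_deriv beta w.
Proof.
intros hb hK.
pose proof (K_c2_pos beta hb) as hKc; pose proof (K_c2_mul beta hb) as hmul.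
pose proof (c_beta_deriv2_pos beta 0) as h2.
assert (hk : 0 < 2 * beta * K) by nra.
assert (hgt : 1 / (2 * beta * K) < c_beta_deriv2 beta 0).
{ apply Rlt_div_l; [lra |].
  assert (0 < 2 * beta * c_beta_deriv2 beta 0) by nra; nra. }
(* The second derivative stays above [1 / (2 * beta * K)] within [d] of 0, so the function given to
   [IVT] is negative at [d / 2]. *)
destruct (continuous_c_beta_deriv2 beta 0 _ (open_gt _ _ hgt)) as [d hd].
pose proof (cond_pos d) as hdp.
destruct (c_beta_deriv_mvt beta 0 (d / 2) ltac:(lra)) as [u [hu hud]].
rewrite c_beta_deriv_0, !Rminus_0_r in hu.
assert (hcu : 1 / (2 * beta * K) < c_beta_deriv2 beta u).
{ apply (hd u); change (Rabs (u - 0) < d); rewrite Rabs_pos_eq; lra. }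
apply (proj1 (Rlt_div_l 1 _ (2 * beta * K) hk)) in hcu.
(* Since [c_beta_deriv] is below 1, the function is positive at this [y]. *)
set (y := d / 2 + 2 * beta * K).
destruct (IVT (fun w => w - 2 * beta * K * c_beta_deriv beta w) (d / 2) y) as [w [hw hw0]].
- intros t; apply continuity_pt_filterlim.
  apply (continuous_minus (fun w => w) (fun w => 2 * beta * K * c_beta_deriv beta w)).
  + apply continuous_id.
  + apply (continuous_scal_r (2 * beta * K) (c_beta_deriv beta)), continuous_c_beta_deriv.
- unfold y; lra.
- rewrite hu; nra.
- pose proof (c_beta_deriv_bounds beta y); unfold y in *; nra.
- exists w; lra.
Qed.

(** The value of [K] for which [w] is a critical point of [free_energy beta K];
    meaningful for [w <> 0], where [c_beta_deriv beta w <> 0]. *)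
Definition critical_K (beta w : R) : R := w / (2 * beta * c_beta_deriv beta w).

Lemma c_beta_deriv_pos (beta w : R) : 0 < w -> 0 < c_beta_deriv beta w.
Proof. intros hw; rewrite <- (c_beta_deriv_0 beta); now apply c_beta_deriv_increasing. Qed.

Lemma critical_K_eq (beta K w : R) : 0 < beta -> 0 < w ->
  K = critical_K beta w <-> w = 2 * beta * K * c_beta_deriv beta w.
Proof.
intros hb hw; pose proof (c_beta_deriv_pos beta w hw).
unfold critical_K; split.
- intros ->; field; lra.
- intros h; rewrite h at 1; field; lra.
Qed.

(** Up to the factor [1 / (2 * beta)], [critical_K] is the reciprocal of the decreasing slope. *)
Lemma critical_K_increasing (beta x y : R) : 0 < beta <= beta_c ->
  0 < x < y -> critical_K beta x < critical_K beta y.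
Proof.
intros [hb hbc] hxy.
pose proof (c_beta_deriv_slope_decreasing beta x y hbc hxy).
pose proof (c_beta_deriv_pos beta x ltac:(lra)).
pose proof (c_beta_deriv_pos beta y ltac:(lra)).
apply Rlt_0_minus; unfold critical_K.
replace (y / (2 * beta * c_beta_deriv beta y) - x / (2 * beta * c_beta_deriv beta x))
  with ((y * c_beta_deriv beta x - x * c_beta_deriv beta y) /
        (2 * beta * c_beta_deriv beta x * c_beta_deriv beta y)) by (field; repeat split; lra).
apply Rdiv_lt_0_compat; [lra | do 3 (apply Rmult_lt_0_compat; [| lra]); lra].
Qed.

Lemma critical_K_lt_inv (beta x y : R) : 0 < beta <= beta_c -> 0 < x -> 0 < y ->
  critical_K beta x < critical_K beta y -> x < y.
Proof.
intros hb hx hy h; destruct (Rtotal_order x y) as [hxy | [-> | hyx]]; [exact hxy | lra |].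
pose proof (critical_K_increasing beta y x hb ltac:(lra)); lra.
Qed.

(** [K_c2] is the same reciprocal taken at the larger slope [c_beta_deriv2 beta 0]. *)
Lemma K_c2_lt_critical_K (beta w : R) : 0 < beta <= beta_c -> 0 < w ->
  K_c2 beta < critical_K beta w.
Proof.
intros [hb hbc] hw.
pose proof (c_beta_deriv_pos beta w hw).
unfold critical_K; apply (proj1 (Rlt_div_r _ _ (2 * beta * c_beta_deriv beta w) ltac:(nra))).
pose proof (K_c2_pos beta hb).
replace w with (K_c2 beta * (2 * beta * (c_beta_deriv2 beta 0 * w))) at 2.
- do 2 (apply Rmult_lt_compat_l; [lra |]).
  now apply c_beta_deriv_lt_linear.
- rewrite <- (Rmult_1_l w) at 2; rewrite <- (K_c2_mul beta hb); ring.
Qed.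

(** Inverse of a strictly increasing function: parameters between [critical_K] at [w K - e] and at
    [w K + e] have their critical point within [e] of [w K]. *)
Lemma continuous_critical_K_inverse (beta K : R) (w : R -> R) : 0 < beta <= beta_c ->
  (forall K', K_c2 beta < K' -> 0 < w K' /\ K' = critical_K beta (w K')) ->
  K_c2 beta < K -> continuous w K.
Proof.
intros hb hw hK; apply filterlim_locally; intros eps.
destruct (hw K hK) as [hwK heq]; pose proof (cond_pos eps).
(* The cap [w K / 2] keeps [w K - e] positive, where [critical_K] is monotone. *)
set (e := Rmin eps (w K / 2)).
assert (0 < e) by (apply Rmin_pos; lra).
pose proof (Rmin_l eps (w K / 2) : e <= eps).
pose proof (Rmin_r eps (w K / 2) : e <= w K / 2).
pose proof (critical_K_increasing beta (w K - e) (w K) hb ltac:(lra)).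
pose proof (critical_K_increasing beta (w K) (w K + e) hb ltac:(lra)).
pose proof (K_c2_lt_critical_K beta (w K - e) hb ltac:(lra)).
apply filter_imp with (fun x => critical_K beta (w K - e) < x /\ x < critical_K beta (w K + e)).
- intros x [hlo hhi]; destruct (hw x ltac:(lra)) as [hx hxeq].
  rewrite hxeq in hlo, hhi.
  apply critical_K_lt_inv in hlo; try lra.
  apply critical_K_lt_inv in hhi; try lra.
  change (Rabs (w x - w K) < eps); apply Rabs_lt_between; lra.
- apply filter_and; [apply open_gt | apply open_lt]; lra.
Qed.

(** One-sided version: [K < critical_K beta eps] forces [w K < eps], and positivity of [w K] bounds
    it below. *)
Lemma filterlim_critical_K_inverse (beta : R) (w : R -> R) : 0 < beta <= beta_c ->
  (forall K, K_c2 beta < K -> 0 < w K /\ K = critical_K beta (w K)) ->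
  filterlim w (at_right (K_c2 beta)) (locally 0).
Proof.
intros hb hw; apply filterlim_locally; intros eps; pose proof (cond_pos eps).
unfold at_right, within.
apply filter_imp with (fun x => x < critical_K beta eps).
- intros x hhi hx; destruct (hw x hx) as [hwx hxeq].
  rewrite hxeq in hhi; apply critical_K_lt_inv in hhi; try lra.
  change (Rabs (w x - 0) < eps); apply Rabs_lt_between; lra.
- apply open_lt, K_c2_lt_critical_K; assumption.
Qed.

Theorem theorem3p6 (beta : R) (hbeta : 0 < beta <= beta_c) :
  (forall K : R, 0 < K <= K_c2 beta ->
     forall z : R, canonical_macrostates beta K z <-> z = 0) /\
  (exists ztilde : R -> R,
     (forall K : R, K_c2 beta < K ->
        0 < ztilde K /\
        forall z : R, canonical_macrostates beta K z <->
                      (z = ztilde K \/ z = - ztilde K)) /\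
     (forall K1 K2 : R, K_c2 beta < K1 -> K1 < K2 -> ztilde K1 < ztilde K2) /\
     (forall K : R, K_c2 beta < K -> continuous ztilde K) /\
     filterlim ztilde (at_right (K_c2 beta)) (locally 0)).
Proof.
split; [intros K hK z; now apply macrostates_subcritical |].
destruct hbeta as [hb hbc].
pose proof (K_c2_pos beta hb) as hKc.
destruct (functional_choice
  (fun K w => K_c2 beta < K -> 0 < w /\ w = 2 * beta * K * c_beta_deriv beta w))
  as [w hw].
{ intros K; destruct (Rlt_dec (K_c2 beta) K) as [h | h].
  - destruct (critical_point_exists beta K hb h) as [w hw]; now exists w.
  (* Default value outside the supercritical range. *)
  - exists 0; lra. }
assert (hwK : forall K, K_c2 beta < K -> 0 < w K /\ K = critical_K beta (w K)).
{ intros K hK; destruct (hw K hK) as [hpos heq]; split; [exact hpos |].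
  now apply critical_K_eq. }
(* This equals [w K / (2 * beta * K)], but as a composition of increasing continuous maps it gives
   monotonicity and continuity directly. *)
exists (fun K => c_beta_deriv beta (w K)); split; [| split; [| split]].
- intros K hK; destruct (hw K hK) as [hpos heq]; split.
  + now apply c_beta_deriv_pos.
  + intros z; apply macrostates_supercritical; lra.
- intros K1 K2 hK1 hK.
  destruct (hwK K1 hK1) as [h1 e1], (hwK K2 ltac:(lra)) as [h2 e2].
  apply c_beta_deriv_increasing, critical_K_lt_inv with beta; lra.
- intros K hK; apply (continuous_comp w (c_beta_deriv beta)).
  + apply continuous_critical_K_inverse with beta; try lra; assumption.
  + apply continuous_c_beta_deriv.
- apply filterlim_comp with (locally 0).
  + apply filterlim_critical_K_inverse; [lra | assumption].
  + rewrite <- (c_beta_deriv_0 beta) at 2; apply continuous_c_beta_deriv.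
Qed.
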